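(* Let $t,r\in\mathbb{R}$ with $t\geq 1$ and $r\geq -\binom{\lfloor t+1\rfloor}{2}$, and put $t_0=\lfloor t\rfloor+1-t$ and $g_0=t\lfloor t\rfloor+r-\binom{\lfloor t\rfloor}{2}$. Suppose $3t_0\leq g_0<8t_0-4$. Then for all sufficiently large $n$ (depending on $t$ and $r$), if $G$ is a graph that attains the maximum spectral radius over all $n$-vertex graphs satisfying the property $P_{t,r}$, then $$G\cong K_{\lfloor t\rfloor}\nabla\big(K_3\cup(n-\lfloor t\rfloor-3)K_1\big).$$
   Context: All graphs are finite, simple and undirected. The spectral radius is that of the adjacency matrix. A graph $G$ has the (Hereditarily Bounded) property $P_{t,r}$ if every subgraph $H\subseteq G$ with $|V(H)|\geq t$ satisfies $|E(H)|\leq t\,|V(H)|+r$. $G_1\nabla G_2$ is the join, obtained from the disjoint union of $G_1$ and $G_2$ by adding all edges between them; $kG$ is the disjoint union of $k$ copies of $G$. *)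

(* Defs.v *)
From mathcomp Require Import all_boot all_order all_algebra.
From mathcomp Require Import complex.
From mathcomp Require Import classical_sets reals.

Set Implicit Arguments.
Unset Strict Implicit.
Unset Printing Implicit Defensive.

Import GRing.Theory Num.Theory.
Local Open Scope ring_scope.

Record sgraph := SGraph {
  vertex :> finType;
  adj : rel vertex;
  adj_sym : symmetric adj;
  adj_irr : irreflexive adj }.

Definition edges (G : sgraph) : {set {set G}} :=
  [set [set x; y] | x in G, y in G & adj x y].

Definition giso (G H : sgraph) : Prop :=
  exists2 f : G -> H, bijective f & forall x y, adj (f x) (f y) = adj x y.

Definition complete_rel n : rel 'I_n := fun i j => i != j.
Lemma complete_sym n : symmetric (@complete_rel n).
Proof. by move=> i j; rewrite /complete_rel eq_sym. Qed.
Lemma complete_irr n : irreflexive (@complete_rel n).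
Proof. by move=> i; rewrite /complete_rel eqxx. Qed.
Definition complete n : sgraph := SGraph (@complete_sym n) (@complete_irr n).

Section Operations.
Variables G H : sgraph.

(* [cross] says whether vertices on different sides are adjacent. *)
Definition sum_rel (cross : bool) : rel (G + H)%type := fun u v =>
  match u, v with
  | inl x, inl y => adj x y
  | inr x, inr y => adj x y
  | _, _ => cross
  end.
Lemma sum_sym cross : symmetric (sum_rel cross).
Proof. by move=> [x|x] [y|y] //=; apply: adj_sym. Qed.
Lemma sum_irr cross : irreflexive (sum_rel cross).
Proof. by move=> [x|x] /=; apply: adj_irr. Qed.

Definition gunion : sgraph := SGraph (sum_sym false) (sum_irr false).
Definition gjoin : sgraph := SGraph (sum_sym true) (sum_irr true).

Definition copies_rel k : rel ('I_k * G)%type :=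
  fun u v => (u.1 == v.1) && adj u.2 v.2.
Lemma copies_sym k : symmetric (@copies_rel k).
Proof. by move=> u v; rewrite /copies_rel eq_sym adj_sym. Qed.
Lemma copies_irr k : irreflexive (@copies_rel k).
Proof. by move=> u; rewrite /copies_rel adj_irr andbF. Qed.
Definition copies k : sgraph := SGraph (@copies_sym k) (@copies_irr k).
End Operations.

Definition adjmx (R : nzRingType) (G : sgraph) : 'M[R]_#|G| :=
  \matrix_(i, j) (adj (enum_val i) (enum_val j))%:R.

(* Maximum modulus of the complex eigenvalues; [sup] is attained as soon as
   [0 < n], there being finitely many eigenvalues and at least one. *)
Definition spectral_radius (R : realType) n (A : 'M[R]_n) : R :=
  sup [set ComplexField.Normc.normc z | z in
    [set z : R[i] | eigenvalue (map_mx (real_complex R) A) z]]%classic.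

Definition rho (R : realType) (G : sgraph) : R := spectral_radius (adjmx R G).

(* A subgraph is a vertex set [W] with a set [F] of edges of [G] inside [W];
   it need not be induced. *)
Definition hereditarily_bounded (R : realType) (t r : R) (G : sgraph) : Prop :=
  forall (W : {set G}) (F : {set {set G}}),
    F \subset edges G -> (forall e, e \in F -> e \subset W) ->
    t <= #|W|%:R -> #|F|%:R <= t * #|W|%:R + r.

Definition max_rho_bounded (R : realType) (t r : R) n (G : sgraph) : Prop :=
  [/\ #|G| = n, hereditarily_bounded t r G &
    forall H : sgraph, #|H| = n -> hereditarily_bounded t r H ->
      rho R H <= rho R G].

(* Main.v *)
Require Import Defs.
From mathcomp Require Import all_boot all_order all_algebra.
From mathcomp Require Import complex.
From mathcomp Require Import classical_sets reals.
From mathcomp Require Import ring lra zify fintype finset.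
Local Open Scope ring_scope.

(** Let [k] be the floor of [t], let [F] be the join of [K_k] with a triangle
    and isolated vertices, let [G] be extremal and [lam] its spectral radius.

    Taking absolute values in a complex eigenvector equation gives a vector
    [0 <= x <= 1], with maximum [1], such that [lam * x <= A x], where [A] is
    the adjacency matrix of [G] ([rho_subeigenvector]).  This inequality
    replaces Perron-Frobenius theory.  The graph [F] has the hereditary
    property ([core_triangle_bounded]) and an explicit eigenvector for some
    [mu] with [mu ^+ 2 >= k * (n - k)] ([core_triangle_eigenvalue],
    [triangle_join_eigenvalue_exists]); hence [mu <= lam].

    The bound on [lam] forces a core.  In a sparse graph most vertices have at
    most [k] neighbours in a small set ([npairs_disjoint_le], because
    [t < k + 1]), and only few entries of [x] are not small.  Counting weighted
    walks of length two from the vertex of weight [1], of which there must be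
    about [k * n], yields [k] vertices of weight close to [1]; these are joined
    to almost everything, so that a further vertex of noticeable weight would
    again violate sparseness ([core_exists]).

    The rest is a duality argument ([subvector_duality]): as [mu <= lam], no
    vector [y >= 0] satisfies [x . A y < mu * (x . y)].  With [y] equal to [1]
    on the core and to [k / mu] elsewhere, every missing pair at the core costs
    more than the edges outside the core, whose number the hereditary property
    bounds in terms of the missing pairs, can gain; so the core is joined to
    everything ([core_dominates]).  Then [g0 < 8 * t0 - 4] leaves room for at
    most three edges outside the core, since already four disjoint edges, the
    sparsest way to place four, are too many.  A graph with at most three edges
    which is neither a triangle nor a claw admits a test vector depending on
    degrees and neighbour degrees only, and the claw admits its own
    ([rest_triangle], [rest_degree_le2]); both contradict duality, and the
    triangle remains. *)

Set Implicit Arguments.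
Unset Strict Implicit.
Unset Printing Implicit Defensive.
Import Order.TTheory GRing.Theory Num.Theory.

(** * The spectral radius as an eigenvalue *)

Lemma eigenvalue_seq (F : closedFieldType) n (A : 'M[F]_n) :
  (0 < n)%N -> exists2 s : seq F, s != [::] & eigenvalue A =i s.
Proof.
move=> n0; have [s Es] := closed_field_poly_normal (char_poly A).
have m := char_poly_monic A; rewrite (monicP m) scale1r in Es.
exists s; last first.
  by move=> z; rewrite -root_prod_XsubC -Es -eigenvalue_root_char.
apply/eqP => s0; have := size_char_poly A.
by rewrite Es s0 big_nil size_poly1; case: n n0 {A Es s0 m}.
Qed.

Lemma seq_argmax (R : realDomainType) (T : eqType) (f : T -> R) (s : seq T) :
  s != [::] -> exists2 z, z \in s & {in s, forall w, f w <= f z}.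
Proof.
elim: s => // a [|b s] IH _.
  by exists a; rewrite ?mem_head // => w; rewrite inE => /eqP->.
have [//|z zs Hz] := IH.
have [le|lt] := leP (f a) (f z).
  exists z; first by rewrite inE zs orbT.
  by move=> w; rewrite inE => /orP[/eqP->|/Hz].
exists a; first exact: mem_head.
move=> w; rewrite inE => /orP[/eqP->//|/Hz h].
exact: le_trans h (ltW lt).
Qed.

Section Spectrum.
Variables (R : realType) (n : nat) (A : 'M[R]_n).
Hypothesis n_gt0 : (0 < n)%N.
Let AC := map_mx (real_complex R) A.

(** The eigenvalues are the roots of the characteristic polynomial, hence form
    a finite nonempty set, and the supremum is a maximum. *)
Lemma spectral_radius_attained :
  exists2 z, eigenvalue AC z & spectral_radius A = ComplexField.Normc.normc z /\
   forall w, eigenvalue AC w -> ComplexField.Normc.normc w <= spectral_radius A.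
Proof.
have [s s0 Hs] := eigenvalue_seq AC n_gt0.
have [z zs Hz] := seq_argmax (@ComplexField.Normc.normc R) s0.
have Ez : eigenvalue AC z by have := zs; rewrite -Hs.
have E w : eigenvalue AC w -> ComplexField.Normc.normc w <= ComplexField.Normc.normc z.
  by move=> Ew; apply: Hz; rewrite -Hs.
exists z => //.
suff -> : spectral_radius A = ComplexField.Normc.normc z by [].
apply/eqP; rewrite eq_le; apply/andP; split.
  apply: ge_sup; first by exists (ComplexField.Normc.normc z), z.
  by move=> _ [w /= Ew <-]; apply: E.
apply: ub_le_sup; last by exists z.
by exists (ComplexField.Normc.normc z) => _ [w /= Ew <-]; apply: E.
Qed.
End Spectrum.

Section GraphSpectrum.
Variables (R : realType) (G : sgraph).
Hypothesis G_gt0 : (0 < #|G|)%N.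

Lemma eigenvector_le_rho (mu : R) (z : G -> R) (v0 : G) :
    z v0 != 0 ->
    (forall v, \sum_u z u * (adj u v)%:R = mu * z v) ->
  mu <= rho R G.
Proof.
move=> z0 Ez.
have [_ _ [_ H]] := spectral_radius_attained (adjmx R G) G_gt0.
have : eigenvalue (map_mx (real_complex R) (adjmx R G)) (real_complex R mu).
  rewrite eigenvalue_map; apply/eigenvalueP.
  exists (\row_i z (enum_val i)).
    apply/rowP => j; rewrite !mxE -Ez [RHS](reindex _ (onW_bij _ (enum_val_bij G))).
    by apply: eq_bigr => i _; rewrite !mxE.
  apply/eqP => /rowP /(_ (enum_rank v0)).
  by rewrite !mxE enum_rankK; apply/eqP.
move=> /H; apply: le_trans.
rewrite /ComplexField.Normc.normc /= expr0n addr0 sqrtr_sqr.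
exact: ler_norm.
Qed.

(** Moduli of the entries of an eigenvector, for an eigenvalue of maximal
    modulus: the triangle inequality turns the eigenvector equation into an
    inequality.  This weak form of the Perron vector suffices, as upper bounds
    on [rho R G * x v] are all that is ever used. *)
Lemma rho_subeigenvector :
  exists (x : G -> R) (v0 : G), [/\ forall v, 0 <= x v <= 1, x v0 = 1 &
    forall v, rho R G * x v <= \sum_u (adj v u)%:R * x u].
Proof.
have [z Ez [Er _]] := spectral_radius_attained (adjmx R G) G_gt0.
have [w Ew w0] := eigenvalueP Ez.
pose y v := ComplexField.Normc.normc (w 0 (enum_rank v)).
have y_ge0 v : 0 <= y v.
  by rewrite /y; case: (w 0 _) => a b; rewrite /= sqrtr_ge0.
have [v0 _ Hv0] : exists2 v0, v0 \in enum G & {in enum G, forall v, y v <= y v0}.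
  by apply: seq_argmax; rewrite -size_eq0 -cardE -lt0n.
have Hv v : y v <= y v0 by apply: Hv0; rewrite mem_enum.
have y0 : 0 < y v0.
  rewrite lt_def y_ge0 andbT; apply/eqP => y0.
  case/eqP: w0; apply/rowP => i; rewrite mxE.
  apply: ComplexField.Normc.eq0_normc; apply/eqP; rewrite eq_le.
  have := Hv (enum_val i); rewrite y0 {1}/y enum_valK => ->.
  by have := y_ge0 (enum_val i); rewrite /y enum_valK => ->.
exists (fun v => y v / y v0), v0; split.
- by move=> v; rewrite divr_ge0 ?y_ge0 //= ler_pdivrMr // mul1r.
- by rewrite divff // gt_eqF.
move=> v; under eq_bigr do rewrite mulrA.
rewrite -mulr_suml mulrA ler_pM2r ?invr_gt0 //.
have /rowP/(_ (enum_rank v)) := Ew; rewrite !mxE => /(congr1 (@ComplexField.Normc.normc R)).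
rewrite ComplexField.Normc.normcM -/(y v) => Ev; rewrite /rho Er -Ev.
rewrite [leRHS](reindex _ (onW_bij _ (enum_val_bij G))) /=.
elim/big_ind2: _ => [|a a' b b' h h'|i _].
- by rewrite ComplexField.Normc.normc0.
- by apply: le_trans (le_normcD _ _) _; apply: lerD.
rewrite ComplexField.Normc.normcM /y enum_valK !mxE enum_rankK adj_sym mulrC.
rewrite ler_wpM2r //; first by case: (w 0 i) => a b; rewrite /= sqrtr_ge0.
by case: adj; rewrite /ComplexField.Normc.normc /= expr0n addr0 ?expr1n ?expr0n ?sqrtr1 ?sqrtr0.
Qed.
End GraphSpectrum.

(** * Counting adjacent pairs *)

(** Sending an ordered pair of adjacent vertices to the edge that it spans is
    two-to-one. *)
Lemma card_edges_within (G : sgraph) (W : {set G}) :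
  (\sum_(u in W) \sum_(v in W) adj u v
     = #|[set e in edges G | e \subset W]|.*2)%N.
Proof.
pose P := [set p : G * G | [&& p.1 \in W, p.2 \in W & adj p.1 p.2]].
transitivity (\sum_(p in P) 1)%N.
  rewrite pair_big /= big_mkcond [RHS]big_mkcond; apply: eq_bigr => -[u v] _ /=.
  by rewrite inE /=; case: (u \in W); case: (v \in W); case: adj.
rewrite (partition_big (fun p => [set p.1; p.2])
           [in [set e in edges G | e \subset W]]) /=; last first.
  move=> [u v]; rewrite !inE /= => /and3P[uW vW uv].
  rewrite subUset !sub1set uW vW !andbT.
  by apply/imset2P; exists u v; rewrite ?inE.
rewrite -muln2 -sum_nat_const; apply: eq_bigr => e.
rewrite inE => /andP[/imset2P[x y _]]; rewrite inE /= => xy -> {e}.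
rewrite subUset !sub1set => /andP[xW yW].
have nxy : x != y by apply: contraTneq xy => ->; rewrite adj_irr.
rewrite sum1dep_card.
suff -> : [set p | (p \in P) && ([set p.1; p.2] == [set x; y])] = [set (x, y); (y, x)].
  by rewrite cards2 xpair_eqE negb_and nxy.
apply/setP => -[u v]; rewrite !inE /= !xpair_eqE.
apply/andP/orP => [[/and3P[_ _ uv]] /eqP E|].
  have nuv : u != v by apply: contraTneq uv => ->; rewrite adj_irr.
  have := set21 u v; rewrite E !inE => /orP[]/eqP Eu;
  have := set22 u v; rewrite E !inE => /orP[]/eqP Ev; subst; rewrite ?eqxx //= in nuv *; auto.
case=> /andP[/eqP-> /eqP->]; rewrite ?xW ?yW ?xy ?eqxx //.
by rewrite adj_sym xy setUC eqxx.
Qed.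

Lemma sum_setU (V : nmodType) (T : finType) (X Y : {set T}) (F : T -> V) :
  [disjoint X & Y] ->
  \sum_(u in X :|: Y) F u = \sum_(u in X) F u + \sum_(u in Y) F u.
Proof.
by move=> dXY; rewrite -bigU //; apply: eq_bigl => u; rewrite !inE.
Qed.

Lemma sum_setT (V : nmodType) (T : finType) (F : T -> V) :
  \sum_(u in [set: T]) F u = \sum_u F u.
Proof. by apply: eq_bigl => u; rewrite inE. Qed.

Section Pairs.
Variables (R : realType) (G : sgraph).
Implicit Types (u v : G) (X Y Z W : {set G}).

Definition degin (X : {set G}) (u : G) : R := \sum_(v in X) (adj u v)%:R.
Definition npairs (X Y : {set G}) : R := \sum_(u in X) degin Y u.

Lemma npairs_edges (W : {set G}) :
  npairs W W = 2 * #|[set e in edges G | e \subset W]|%:R.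
Proof.
rewrite -natrM mul2n -card_edges_within natr_sum; apply: eq_bigr => u _.
by rewrite natr_sum.
Qed.

(** Sums over ordered pairs are easier to split than sets of edges, and taking
    all edges inside [W] is the worst case of the property. *)
Lemma hereditarily_boundedE (t r : R) :
  hereditarily_bounded t r G <->
  (forall W : {set G}, t <= #|W|%:R -> npairs W W <= 2 * (t * #|W|%:R + r)).
Proof.
split=> [H W tW|H W F FE FW tW].
  rewrite npairs_edges ler_pM2l //; apply: H => //.
    by apply/subsetP => e; rewrite inE => /andP[].
  by move=> e; rewrite inE => /andP[].
rewrite -(ler_pM2l (ltr0n R 2)); apply: le_trans (H W tW).
rewrite npairs_edges ler_pM2l // ler_nat; apply/subset_leq_card/subsetP => e eF.
by rewrite inE (subsetP FE) ?FW.
Qed.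

Lemma degin_ge0 X u : 0 <= degin X u.
Proof. by apply: sumr_ge0 => v _; rewrite ler0n. Qed.

Lemma degin_le_card X u : degin X u <= #|X|%:R.
Proof.
rewrite -sum1_card natr_sum; apply: ler_sum => v _.
by case: adj.
Qed.

Lemma npairs_ge0 X Y : 0 <= npairs X Y.
Proof. by apply: sumr_ge0 => u _; apply: degin_ge0. Qed.

Lemma npairsC X Y : npairs X Y = npairs Y X.
Proof.
rewrite /npairs /degin exchange_big; apply: eq_bigr => u _.
by apply: eq_bigr => v _; rewrite adj_sym.
Qed.

Lemma npairs_le_card X : npairs X X <= #|X|%:R * #|X|%:R.
Proof.
rewrite -[leRHS]mulrC mulr_natr -sumr_const; apply: ler_sum => u _.
exact: degin_le_card.
Qed.

Lemma deginU X Y u : [disjoint X & Y] -> degin (X :|: Y) u = degin X u + degin Y u.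
Proof. by move=> dXY; rewrite /degin sum_setU. Qed.

Lemma npairsUl X Y Z : [disjoint X & Y] -> npairs (X :|: Y) Z = npairs X Z + npairs Y Z.
Proof. by move=> dXY; rewrite /npairs sum_setU. Qed.

Lemma npairsUr X Y Z : [disjoint X & Y] -> npairs Z (X :|: Y) = npairs Z X + npairs Z Y.
Proof. by move=> dXY; rewrite npairsC npairsUl // !(npairsC Z). Qed.

Lemma npairsUU X Y : [disjoint X & Y] ->
  npairs (X :|: Y) (X :|: Y) = npairs X X + 2 * npairs X Y + npairs Y Y.
Proof.
move=> dXY; rewrite npairsUl // !npairsUr // (npairsC Y X); ring.
Qed.

Lemma ler_npairs X X' Y Y' : X \subset X' -> Y \subset Y' -> npairs X Y <= npairs X' Y'.
Proof.
move=> sX sY; rewrite /npairs /degin big_mkcond [leRHS]big_mkcond.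
apply: ler_sum => u _; case: ifP => [/(subsetP sX)->|_].
  rewrite big_mkcond [leRHS]big_mkcond; apply: ler_sum => v _.
  case: ifP => [/(subsetP sY)->//|_]; case: ifP => // _; exact: ler0n.
case: ifP => // _; exact: degin_ge0.
Qed.
End Pairs.

(** * Walks of length two in sparse graphs *)

Section Sparse.
Variables (R : realType) (G : sgraph).
Implicit Types (u v w : G) (X Y Z W L : {set G}).
Local Notation a u v := ((adj u v)%:R : R).
Local Notation deg := (@degin R G).
Local Notation prs := (@npairs R G).
Local Notation n := (#|G|%:R : R).

Lemma degin_nat X u : deg X u = #|[set v in X | adj u v]|%:R.
Proof.
rewrite -sum1_card natr_sum [RHS]big_mkcond [LHS]big_mkcond.
by apply: eq_bigr => v _; rewrite inE; case: (v \in X); case: adj.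
Qed.

Implicit Types (f g : G -> R).

(** Total weight of the walks [v - w - u] with [w] outside and [u] inside [L],
    each weighted by [f u]. *)
Definition walk2 L f v : R := \sum_(w in ~: L) a v w * \sum_(u in L) a w u * f u.

Lemma walk2D L f g v : walk2 L (fun u => f u + g u) v = walk2 L f v + walk2 L g v.
Proof.
rewrite /walk2 -big_split; apply: eq_bigr => w _ /=; rewrite -mulrDr -big_split.
by congr (_ * _); apply: eq_bigr => u _; rewrite mulrDr.
Qed.

Lemma walk2Z L b f v : walk2 L (fun u => b * f u) v = b * walk2 L f v.
Proof.
rewrite /walk2 mulr_sumr; apply: eq_bigr => w _; rewrite mulrCA; congr (_ * _).
by rewrite mulr_sumr; apply: eq_bigr => u _; rewrite mulrCA.
Qed.

Lemma le_walk2 L f g v : (forall u, f u <= g u) -> walk2 L f v <= walk2 L g v.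
Proof.
move=> fg; apply: ler_sum => w _; apply: ler_wpM2l; first exact: ler0n.
by apply: ler_sum => u _; apply: ler_wpM2l; rewrite ?ler0n.
Qed.

Lemma walk2_indic L (S : {set G}) v : walk2 L (fun u => (u \in S)%:R) v <= #|S|%:R * n.
Proof.
rewrite -cardsT mulr_natr -sumr_const sum_setT /walk2 big_mkcond /=.
apply: ler_sum => w _; case: ifP => _; last exact: ler0n.
apply: le_trans (degin_le_card R S w).
apply: le_trans (_ : \sum_(u in L) a w u * (u \in S)%:R <= _).
  rewrite ler_piMl //; last by case: adj.
  by apply: sumr_ge0 => u _; rewrite mulr_ge0 ?ler0n.
rewrite /degin big_mkcond [leRHS]big_mkcond; apply: ler_sum => u _ /=.
by case: (u \in L); case: (u \in S); rewrite ?mulr1 ?mulr0 ?ler0n.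
Qed.

Variables (t c : R) (k : nat).
Hypotheses (kt : k%:R <= t) (tk : t - k%:R <= 1 / 5).
Hypothesis sparse : forall W, prs W W <= 2 * (t * #|W|%:R + c).

(** The vertices of [X] with more than [k] neighbours in [L] span with [L] more
    than [k] edges per vertex of [X], whereas sparseness allows only [t < k + 1]:
    so these vertices, and their surplus of edges over [k], are bounded in terms
    of [#|L|]. *)
Lemma npairs_disjoint_le L X : [disjoint X & L] ->
  prs X L <= k%:R * #|X|%:R + 2 * (t * #|L|%:R + c).
Proof.
move=> dXL; pose M := [set w in X | (k < #|[set v in L | adj w v]|)%N].
have sMX : M \subset X by apply/subsetP => w; rewrite inE => /andP[].
have dML : [disjoint M & L] by apply: disjointWl dXL.
have H := sparse (M :|: L); rewrite npairsUU // cardsU disjoint_setI0 // cards0 subn0 natrD in H.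
have := npairs_ge0 R M M; have := npairs_ge0 R L L => HL HM.
have lb : (k%:R + 1) * #|M|%:R <= prs M L.
  rewrite mulr_natr -sumr_const; apply: ler_sum => w; rewrite inE => /andP[_ h].
  by rewrite degin_nat natr1 ler_nat.
have -> : prs X L = prs M L + prs (X :\: M) L.
  rewrite -{1}(setID X M) (setIidPr sMX) npairsUl //.
  by rewrite disjoint_sym disjoints_subset setDE subsetIr.
have ub : prs (X :\: M) L <= k%:R * #|X :\: M|%:R.
  rewrite mulr_natr -sumr_const; apply: ler_sum => w; rewrite !inE => /andP[h wX].
  by rewrite wX /= -leqNgt in h; rewrite degin_nat ler_nat.
have cX : #|X|%:R = #|M|%:R + #|X :\: M|%:R :> R.
  by rewrite -natrD -(cardsID M X) (setIidPr sMX).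
have m0 := ler0n R #|M|; have l0 := ler0n R #|L|.
have t0 : 0 <= t by apply: le_trans kt.
(* The surplus [s = prs M L - k * #|M|] is at least [#|M|], and by sparseness
   [s <= (t - k) * #|M| + t * #|L| + c <= s / 5 + t * #|L| + c]. *)
have := ler_wpM2r m0 tk; have := mulr_ge0 t0 l0.
rewrite cX; nra.
Qed.

Lemma walk2_one_le L v :
  walk2 L (fun=> 1) v <= k%:R * deg setT v + 2 * (t * #|L|%:R + c).
Proof.
pose X := [set w in ~: L | adj v w].
have -> : walk2 L (fun=> 1) v = prs X L.
  rewrite /walk2 /npairs big_mkcond [RHS]big_mkcond; apply: eq_bigr => w _.
  rewrite !inE; case: (~~ _) => //=; case: adj; rewrite ?mul0r // mul1r.
  by apply: eq_bigr => u _; rewrite mulr1.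
apply: le_trans (npairs_disjoint_le _) _.
  by rewrite disjoints_subset; apply/subsetP => w; rewrite inE => /andP[].
rewrite lerD2r ler_wpM2l ?ler0n // degin_nat ler_nat.
by apply/subset_leq_card/subsetP => w; rewrite !inE => /andP[].
Qed.

Variables (lam : R) (x : G -> R).
Hypotheses (lam_gt0 : 0 < lam) (x01 : forall v, 0 <= x v <= 1).
Hypothesis sub : forall v, lam * x v <= \sum_u a v u * x u.

Let x_ge0 v : 0 <= x v. Proof. by case/andP: (x01 v). Qed.
Let x_le1 v : x v <= 1. Proof. by case/andP: (x01 v). Qed.

Lemma sub_le_deg v : lam * x v <= deg setT v.
Proof.
apply: le_trans (sub v) _; rewrite /degin sum_setT; apply: ler_sum => u _.
by rewrite ler_piMr // ler0n.
Qed.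

Variable eps : R.
Hypothesis eps_gt0 : 0 < eps.
Let L := [set v | eps <= x v].

(** A vertex of weight at least [eps] has degree at least [eps * lam], and [G]
    has linearly many edges; as [lam] has the order of the square root of the
    number of vertices, large weights are a vanishing proportion. *)
Lemma card_large : eps * lam * #|L|%:R <= 2 * (t * n + c).
Proof.
apply: le_trans (_ : prs setT setT <= _); last first.
  by have := sparse setT; rewrite cardsT.
apply: le_trans (_ : prs L setT <= _); last by apply: ler_npairs; rewrite ?subsetT.
rewrite mulr_natr -sumr_const; apply: ler_sum => v; rewrite inE => h.
by apply: le_trans (sub_le_deg v); rewrite mulrC ler_pM2l.
Qed.

(** Iterating [lam * x <= A x] bounds [lam ^+ 2 * x v] by the weight of all
    walks of length two from [v].  Those with both last vertices in [L] are
    paid for by the edges inside [L], and those ending outside [L] carry weight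
    less than [eps]. *)
Lemma lam2_le_walk2 v :
  lam ^+ 2 * x v <= walk2 L x v + 2 * (t * #|L|%:R + c) + 2 * eps * (t * n + c).
Proof.
have H1 : lam ^+ 2 * x v <= \sum_w a v w * \sum_u a w u * x u.
  rewrite expr2 -mulrA; apply: le_trans (_ : lam * (\sum_u a v u * x u) <= _).
    by rewrite ler_pM2l.
  rewrite mulr_sumr; apply: ler_sum => w _; rewrite mulrCA.
  by apply: ler_wpM2l => //; exact: ler0n.
apply: le_trans H1 _.
have E w : \sum_u a w u * x u = \sum_(u in L) a w u * x u + \sum_(u in ~: L) a w u * x u.
  by rewrite -sum_setU ?setUCr ?sum_setT // disjoints_subset setCK.
under eq_bigr do rewrite E mulrDr.
rewrite big_split; apply: lerD.
  rewrite -sum_setT /= -(setUCr L) sum_setU ?disjoints_subset ?setCK // addrC lerD2l.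
  apply: le_trans (sparse L); apply: ler_sum => w _.
  apply: le_trans (_ : \sum_(u in L) a w u * x u <= _).
    rewrite ler_piMl //; last by case: adj.
    by apply: sumr_ge0 => u _; rewrite mulr_ge0 ?ler0n.
  by apply: ler_sum => u _; rewrite ler_piMr ?ler0n.
apply: le_trans (_ : eps * prs setT setT <= _); last first.
  by have := sparse setT; rewrite cardsT [2 * eps]mulrC -mulrA => h; rewrite ler_pM2l.
rewrite mulr_sumr sum_setT; apply: ler_sum => w _.
apply: le_trans (_ : \sum_(u in ~: L) a w u * x u <= _).
  rewrite ler_piMl //; last by case: adj.
  by apply: sumr_ge0 => u _; rewrite mulr_ge0 ?ler0n.
rewrite /degin sum_setT mulr_sumr big_mkcond; apply: ler_sum => u _.
rewrite !inE -ltNge; case: ifP => [/ltW h|_]; last by rewrite mulr_ge0 ?ler0n ?ltW.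
by rewrite mulrC; apply: ler_wpM2r; rewrite ?ler0n.
Qed.

End Sparse.

(** * The core *)

Lemma subset_of_card (T : finType) (A : {set T}) (k : nat) : (k <= #|A|)%N ->
  exists2 B : {set T}, B \subset A & #|B| = k.
Proof.
case/card_geqP => s [us <- sA]; exists [set x in s].
  by apply/subsetP => x; rewrite inE; apply: sA.
by rewrite cardsE; apply/card_uniqP.
Qed.

Section Core.
Variables (R : realType) (G : sgraph) (t c : R) (k : nat).
Hypotheses (kt : k%:R <= t) (tk : t - k%:R <= 1 / 5) (k_gt0 : (0 < k)%N).
Hypothesis sparse : forall W : {set G}, npairs R W W <= 2 * (t * #|W|%:R + c).
Variables (lam : R) (x : G -> R) (v0 : G).
Hypotheses (lam_gt0 : 0 < lam) (x01 : forall v, 0 <= x v <= 1) (x_v0 : x v0 = 1).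
Hypothesis sub : forall v, lam * x v <= \sum_u (adj v u)%:R * x u.
Local Notation n := (#|G|%:R : R).
Local Notation K := (k%:R : R).
Hypothesis lam_lb : K * (n - K) <= lam ^+ 2.
Variable eps : R.
Hypothesis eps_gt0 : 0 < eps.
Let L := [set v | eps <= x v].
Let E : R := 1 / (800 * K).
(* [E * n] is the error tolerated in each estimate below.  The size of [E] is
   dictated by [core_subset], where errors are multiplied by [k] and the total
   has to stay below [n / 50]. *)
Hypotheses (err : 4 * (t * #|L|%:R + c) + 2 * eps * (t * n + c) <= E * n)
  (err_k : K ^+ 2 <= E * n)
  (err_K : (K + 1) ^+ 2 + 2 * (t * (K + 1) + c) <= E * n).

Let K1 : 1 <= K. Proof. by rewrite ler1n. Qed.
Let K_gt0 : 0 < K. Proof. exact: lt_le_trans ltr01 K1. Qed.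
Let K_neq0 : K != 0. Proof. by rewrite gt_eqF ?K_gt0. Qed.
Let E_gt0 : 0 < E. Proof. by rewrite divr_gt0 // mulr_gt0 // (lt_le_trans ltr01 K1). Qed.
Let EK : E * K = 1 / 800. Proof. rewrite /E; field; exact: K_neq0. Qed.
Let E_le : E <= 1 / 800. Proof. by rewrite -EK ler_peMr ?K1 ?(ltW E_gt0). Qed.
Let n_ge0 : 0 <= n. Proof. exact: ler0n. Qed.
Let n_gt0 : 0 < n. Proof. by rewrite ltr0n; apply/card_gt0P; exists v0. Qed.

Let lam2_lb v : K * n * x v <= lam ^+ 2 * x v + E * n.
Proof.
have /andP[x0 x1] := x01 v.
have h : 0 <= K ^+ 2 * (1 - x v) by rewrite mulr_ge0 ?sqr_ge0 // subr_ge0.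
have := ler_wpM2r x0 lam_lb; move: err_k h; rewrite expr2; nra.
Qed.

(** A vertex of weight [x v] starts about [lam ^+ 2 * x v], that is at least
    [k * n * x v], weighted walks of length two, and each neighbour carries at
    most [k] of them on average. *)
Lemma degree_ge v : (x v - 2 * E) * n <= degin R setT v.
Proof.
have h1 := lam2_lb v.
have h2 := lam2_le_walk2 sparse lam_gt0 x01 sub eps_gt0 v.
have h3 := walk2_one_le kt tk sparse L v.
have h4 : walk2 L x v <= walk2 L (fun=> 1) v.
  by apply: le_walk2 => u; case/andP: (x01 u).
rewrite -/L in h2.
have h5 : K * ((x v - 2 * E) * n) <= K * degin R setT v.
  have h6 : E * n <= K * (E * n) by rewrite ler_peMl // mulr_ge0 // ltW.
  move: h1 h2 h3 h4 h6 err.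
  lra.
by rewrite ler_pM2l // in h5; lra.
Qed.

Let sigma : R := 1 / (100 * K).

(** Around [v0], of weight [1], the inequality of [degree_ge] is nearly tight:
    [v0] starts about [k * n] walks of length two into [L], and their end points
    have weight nearly [1] on average.  Hence the end points lighter than
    [1 - sigma] account for few walks, and since at most [n] walks end at any
    given vertex, at least [k] vertices are heavy. *)
Lemma card_heavy : (k <= #|[set v | (1 - sigma <= x v)%R]|)%N.
Proof.
set S := [set v | _].
have h1 := lam2_lb v0.
have h2 := lam2_le_walk2 sparse lam_gt0 x01 sub eps_gt0 v0.
have h3 := walk2_one_le kt tk sparse L v0.
have sK : sigma * K = 1 / 100 by rewrite /sigma; field; exact: K_neq0.
have s_gt0 : 0 < sigma by by rewrite divr_gt0 // mulr_gt0 // K_gt0.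
have Es : E * sigma^-1 = 1 / 8.
  have s8 : E = sigma * (1 / 8) by rewrite /E /sigma; field; exact: K_neq0.
  by rewrite s8 mulrAC divff ?mul1r // gt_eqF.
have h4 : walk2 L (fun=> 1) v0 = walk2 L x v0 + walk2 L (fun u => 1 - x u) v0.
  by rewrite -walk2D; apply: eq_bigr => w _; congr (_ * _); apply: eq_bigr => u _; congr (_ * _); ring.
(* Markov's inequality for the defect [1 - x u]. *)
have h5 : walk2 L x v0 <= walk2 L (fun u => (u \in S)%:R) v0 + sigma^-1 * walk2 L (fun u => 1 - x u) v0.
  rewrite -walk2Z -walk2D; apply: le_walk2 => u; rewrite inE.
  have /andP[x0 x1] := x01 u.
  case: (leP (1 - sigma) (x u)) => h.
    by rewrite mulr1n (le_trans x1) // lerDl mulr_ge0 ?invr_ge0 ?subr_ge0 // ltW.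
  rewrite mulr0n add0r mulrC ler_pdivlMr //.
  apply: le_trans (_ : sigma <= _); first by rewrite ler_piMl // ltW.
  lra.
have h6 := walk2_indic R L S v0.
have dn : degin R setT v0 <= n by rewrite -cardsT degin_le_card.
rewrite -/L x_v0 !mulr1 in h1 h2.
have h7 : walk2 L (fun u => 1 - x u) v0 <= 2 * (E * n).
  have := ler_wpM2l (ler0n R k) dn => HH; move: h1 h2 h3 h4 err HH; lra.
have h8 : sigma^-1 * walk2 L (fun u => 1 - x u) v0 <= 1 / 4 * n.
  apply: le_trans (_ : sigma^-1 * (2 * (E * n)) <= _).
    by rewrite ler_pM2l // invr_gt0.
  have -> : sigma^-1 * (2 * (E * n)) = E * sigma^-1 * (2 * n) by ring.
  by rewrite Es; lra.
have h9 : (K - 1) * n < #|S|%:R * n.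
  have := ler_wpM2r n_ge0 E_le.
  have := le_trans (npairs_ge0 R L L) (sparse L).
  move: h1 h2 h5 h6 h8 err n_gt0; lra.
rewrite ltr_pM2r // in h9.
rewrite -ltnS -(ltr_nat R) -natr1; lra.
Qed.

(** Any [k] heavy vertices are adjacent to nearly all vertices.  By
    [npairs_disjoint_le] a further vertex [v] has few neighbours, since all the
    edges into the heavy vertices and [v] number at most about [k * n]; then
    [degree_ge] makes [v] light. *)
Lemma core_subset : exists L0 : {set G},
  [/\ #|L0| = k, {in L0, forall v, 1 / 2 <= x v} & forall v, v \notin L0 -> x v <= 1 / 50].
Proof.
have [L0 sL0 cL0] := subset_of_card card_heavy.
have sK : sigma * K = 1 / 100 by rewrite /sigma; field; exact: K_neq0.
have s_le : sigma <= 1 / 100 by rewrite -sK ler_peMr ?K1 // divr_ge0 ?mulr_ge0 ?(ltW K_gt0).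
have HL v : v \in L0 -> 1 - sigma <= x v by move/(subsetP sL0); rewrite inE.
exists L0; split=> // [v /HL|v vL0]; first lra.
pose L1 := v |: L0; have cL1 : #|L1| = k.+1 by rewrite cardsU1 vL0 cL0.
have dis : [disjoint ~: L1 & L1] by rewrite disjoints_subset.
have h1 := npairs_disjoint_le kt tk sparse dis.
have h2 : npairs R setT L1 = npairs R (~: L1) L1 + npairs R L1 L1.
  by rewrite -npairsUl // setUC setUCr.
have h3 := npairs_le_card R L1.
have h4 : #|~: L1|%:R <= n by rewrite ler_nat max_card.
rewrite cL1 -(natr1 k) in h1 h3.
have h5 : degin R setT v + K * ((1 - sigma - 2 * E) * n) <= npairs R setT L1.
  rewrite npairsC /npairs big_setU1 //= lerD2l -cL0 mulr_natl -sumr_const.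
  apply: ler_sum => u uL0; apply: le_trans (degree_ge u).
  by rewrite ler_wpM2r // lerD2r HL.
have h6 := degree_ge v.
have h7 := ler_wpM2l (ler0n R k) h4.
have h8 : x v * n <= 1 / 50 * n.
  have e1 : K * ((1 - sigma - 2 * E) * n) = K * n - (sigma * K) * n - 2 * (E * K) * n by ring.
  rewrite e1 EK sK in h5.
  have := ler_wpM2r n_ge0 E_le; move: err_K h1 h2 h3 h5 h6 h7; rewrite expr2.
  move: n_ge0; lra.
by rewrite ler_pM2r // in h8.
Qed.
End Core.

(** The bounds [1 / 2] and [1 / 50] are absolute constants: they are what
    [core_dominates] needs to outweigh the edges outside the core. *)
Lemma core_exists (R : realType) (t c : R) (k : nat) :
    k%:R <= t -> t - k%:R <= 1 / 5 -> (0 < k)%N -> 0 <= c ->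
  exists N : nat, forall G : sgraph, (N <= #|G|)%N ->
    (forall W : {set G}, npairs R W W <= 2 * (t * #|W|%:R + c)) ->
  forall (lam : R) (x : G -> R) (v0 : G), 0 < lam ->
    (forall v, 0 <= x v <= 1) -> x v0 = 1 ->
    (forall v, lam * x v <= \sum_u (adj v u)%:R * x u) ->
    k%:R * (#|G|%:R - k%:R) <= lam ^+ 2 ->
  exists L0 : {set G},
  [/\ #|L0| = k, {in L0, forall v, 1 / 2 <= x v} & forall v, v \notin L0 -> x v <= 1 / 50].
Proof.
move=> kt tk k_gt0 c_ge0.
set K : R := k%:R in kt tk *.
have K1 : 1 <= K by rewrite ler1n.
pose E : R := 1 / (800 * K).
have E_gt0 : 0 < E by rewrite /E divr_gt0 //; lra.
have tc0 : 0 < t + c by lra.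
have t_gt0 : 0 < t by lra.
(* [eps] makes the walks ending at a light vertex cost [E * n / 4]; once
   [lam >= Lam], there are so few other vertices that the edges among them cost
   [E * n / 4] as well. *)
pose eps : R := E / (8 * (t + c)).
have eps_gt0 : 0 < eps by rewrite divr_gt0 // mulr_gt0.
have epsE : eps * (t + c) = 1 / 8 * E by rewrite /eps; field; rewrite gt_eqF.
clearbody eps.
pose Lam : R := 32 * t * (t + c) / (eps * E).
have Lam_gt0 : 0 < Lam by apply: divr_gt0 (mulr_gt0 (mulr_gt0 _ t_gt0) tc0) (mulr_gt0 eps_gt0 E_gt0).
pose B : R := (K + 1) ^+ 2 + 2 * (t * (K + 1) + c).
have t0 : 0 <= t by lra.
have B_ge : K ^+ 2 <= B /\ 0 <= B.
  have := mulr_ge0 t0 (ler0n R k); have := sqr_ge0 K.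
  by rewrite /B -/K !expr2; split; lra.
pose N0 : R := K + Lam ^+ 2 + 16 * c / E + B / E + 1.
exists (Num.truncn N0).+1 => G NG sparse lam x v0 lam_gt0 x01 xv0 sub lam_lb.
have c16 : 0 <= 16 * c / E by apply: divr_ge0 (mulr_ge0 _ c_ge0) (ltW E_gt0).
have BE0 : 0 <= B / E by apply: divr_ge0 (B_ge.2) (ltW E_gt0).
have nN : N0 <= #|G|%:R.
  apply: le_trans (ltW (truncnS_gt N0)) _; by rewrite ler_nat.
set n : R := #|G|%:R in lam_lb nN.
have L2 := sqr_ge0 Lam.
have n1 : 1 <= n by move: nN c16 BE0 L2 K1; rewrite /N0; lra.
have n_gt0 : 0 < n by lra.
have h16 : 16 * c <= E * n.
  by rewrite [E * n]mulrC -ler_pdivrMr //; move: nN c16 BE0 L2 K1; rewrite /N0; lra.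
have hB : B <= E * n.
  by rewrite [E * n]mulrC -ler_pdivrMr //; move: nN c16 BE0 L2 K1; rewrite /N0; lra.
have lam_ge : Lam <= lam.
  rewrite -(@ler_pXn2r _ 2) ?nnegrE ?(ltW lam_gt0) ?(ltW Lam_gt0) //; apply: le_trans _ lam_lb.
  have h : Lam ^+ 2 <= n - K by move: nN c16 BE0 L2 K1; rewrite /N0; lra.
  apply: le_trans h _; rewrite ler_peMl //.
  by move: nN c16 BE0 L2 K1; rewrite /N0; lra.
apply: (@core_subset R G t c k kt tk k_gt0 sparse lam x v0 lam_gt0 x01 xv0 sub lam_lb eps eps_gt0).
- have h := card_large sparse lam_gt0 x01 sub eps.
  set l : R := #|_|%:R in h *.
  rewrite -/K -/E -/n in h *.
  have l0 : 0 <= l by exact: ler0n.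
  have h1 : eps * Lam * l <= 2 * (t * n + c).
    apply: le_trans h; rewrite ler_wpM2r // ler_pM2l //.
  have e1 : eps * Lam = 32 * t * (t + c) / E.
    by rewrite /Lam; field; rewrite !gt_eqF.
  have cn : c <= c * n by rewrite ler_peMr.
  have h2 : (t + c) * (32 * t * l) <= (t + c) * (2 * E * n).
    have -> : (t + c) * (32 * t * l) = E * (eps * Lam * l).
      by rewrite e1; field; rewrite gt_eqF.
    apply: le_trans (_ : E * (2 * (t * n + c)) <= _); first by rewrite ler_pM2l.
    have -> : (t + c) * (2 * E * n) = E * (2 * (t * n + c * n)) by ring.
    by rewrite ler_pM2l // ler_pM2l // lerD2l.
  rewrite ler_pM2l // in h2.
  have h3 : 2 * eps * (t * n + c) <= 1 / 4 * E * n.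
    have -> : 1 / 4 * E * n = 2 * eps * ((t + c) * n).
      by rewrite mulrA -(mulrA 2) epsE; lra.
    rewrite ler_pM2l ?mulr_gt0 //; move: cn; lra.
  move: h2 h3 h16; lra.
- by apply: le_trans hB; case: B_ge.
exact: hB.
Qed.

(** * Excluding every competitor *)

Lemma natr_bin2 (R : comPzRingType) k : 2 * 'C(k, 2)%:R = k%:R * (k%:R - 1) :> R.
Proof.
elim: k => [|k IH]; first by rewrite bin0n mulr0 mul0r.
by rewrite binS bin1 natrD mulrDr IH -(natr1 k); ring.
Qed.

Section Endgame.
Variables (R : realType) (G : sgraph) (k : nat) (t r : R).
Local Notation K := (k%:R : R).
Local Notation n := (#|G|%:R : R).
Local Notation a u v := ((adj u v)%:R : R).
Local Notation deg := (@degin R G).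
Local Notation prs := (@npairs R G).

Variables (lam mu : R) (x : G -> R).
Hypotheses (mu_le : mu <= lam) (x_ge0 : forall v, 0 <= x v).
Hypothesis sub : forall v, lam * x v <= \sum_u a v u * x u.

(** Evaluate [x . A y] in both ways, by symmetry of [A]. *)
Lemma subvector_duality (y : G -> R) : (forall v, 0 <= y v) ->
  mu * (\sum_v x v * y v) <= \sum_v x v * \sum_u a v u * y u.
Proof.
move=> y_ge0.
have xy_ge0 : 0 <= \sum_v x v * y v by apply: sumr_ge0 => v _; rewrite mulr_ge0.
apply: le_trans (ler_wpM2r xy_ge0 mu_le) _.
have -> : \sum_v x v * (\sum_u a v u * y u) = \sum_v y v * \sum_u a v u * x u.
  under eq_bigr do rewrite mulr_sumr.
  rewrite exchange_big; apply: eq_bigr => u _ /=; rewrite mulr_sumr.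
  by apply: eq_bigr => v _; rewrite adj_sym; ring.
rewrite mulr_sumr; apply: ler_sum => v _.
have -> : lam * (x v * y v) = y v * (lam * x v) by ring.
exact: ler_wpM2l.
Qed.

Variable L : {set G}.
Hypothesis cL : #|L| = k.
Local Notation Q := (~: L).

Let cardQ : #|Q|%:R = n - K.
Proof. by rewrite -cL -(cardsC L) natrD addrC addKr. Qed.

Let cL1 l : l \in L -> #|L :\ l|%:R = K - 1.
Proof. by move=> lL; rewrite -cL (cardsD1 l L) lL add1n -[in RHS]natr1 addrK. Qed.

Let sum_split (F : G -> R) : \sum_v F v = \sum_(v in L) F v + \sum_(v in Q) F v.
Proof. by rewrite -sum_setU ?setUCr ?sum_setT // disjoints_subset setCK. Qed.

Definition nonadj (v : G) : nat := #|[set u | (u != v) && ~~ adj v u]|.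

Lemma degin_nonadj (X : {set G}) v :
  #|X|%:R <= deg X v + (v \in X)%:R + (nonadj v)%:R.
Proof.
rewrite degin_nat -!natrD ler_nat.
rewrite -(cardsID [set u | adj v u] X) -addnA.
have -> : X :&: [set u | adj v u] = [set u in X | adj v u].
  by apply/setP => u; rewrite !inE.
rewrite leq_add2l -(cardsID [set v] (X :\: _)) leq_add //.
  case vX: (v \in X); last first.
    rewrite leqn0 cards_eq0; apply/eqP/setP => u; rewrite !inE.
    by apply/negP => /andP[/andP[_ uX] /eqP E]; rewrite -E uX in vX.
  by rewrite (leq_trans (subset_leq_card (subsetIr _ _))) ?cards1.
by apply/subset_leq_card/subsetP => u; rewrite !inE => /and3P[-> ->].
Qed.

Lemma deginT_nonadj v : deg setT v + 1 + (nonadj v)%:R = n.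
Proof.
rewrite degin_nat natr1 -natrD -addn1; congr (_%:R).
rewrite -cardsT -(cardsID [set u | adj v u] setT) -addnA; congr (_ + _)%N.
  by apply: eq_card => u; rewrite !inE.
rewrite -(cardsID [set v] (setT :\: _)); congr (_ + _)%N.
  apply/esym/eqP/cards1P; exists v; apply/setP => u; rewrite !inE.
  by case: (eqVneq u v) => [->|_]; rewrite ?adj_irr ?andbF.
by apply: eq_card => u; rewrite !inE andbT.
Qed.

Let miss : nat := \sum_(l in L) nonadj l.

Section Excess.
Let t0 : R := K + 1 - t.
Let g0 : R := t * K + r - 'C(k, 2)%:R.
Hypotheses (kt : K <= t) (tk : t - K <= 1 / 5) (g0_ge0 : 0 <= g0).
Hypothesis bounded : forall W : {set G}, t <= #|W|%:R ->
  prs W W <= 2 * (t * #|W|%:R + r).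

(** Apply the property to the core together with the [a] non-isolated vertices
    outside it.  If [e] edges lie outside, then [a <= 2 * e], whence
    [e <= (t - k) * a + g0 + miss <= 2 * (1 - t0) * e + g0 + miss]. *)
Lemma npairs_rest : (2 * t0 - 1) * prs Q Q <= 2 * g0 + 2 * miss%:R.
Proof.
pose A := [set u in Q | (0 < #|[set v in Q | adj u v]|)%N].
have sAQ : A \subset Q by apply/subsetP => u; rewrite inE => /andP[].
have dLA : [disjoint L & A].
  by rewrite disjoint_sym disjoints_subset.
have dA u : u \in Q -> deg A u = deg Q u.
  move=> uQ; rewrite !degin_nat; congr (_%:R); apply: eq_card => v.
  rewrite inE [RHS]inE; case: (boolP (v \in Q)) => vQ; last first.
    by rewrite inE (negPf vQ).
  rewrite inE vQ /=; case: (boolP (adj u v)) => uv; last by rewrite andbF.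
  by rewrite andbT; apply/card_gt0P; exists u; rewrite inE uQ adj_sym.
have eA : prs A A = prs Q Q.
  rewrite /npairs [RHS](big_setID A) /= (setIidPr sAQ) [X in _ + X]big1 ?addr0.
    by apply: eq_bigr => u /(subsetP sAQ) /dA.
  move=> u; rewrite in_setD inE degin_nat => /andP[h uQ].
  by move: h; rewrite uQ /= -leqNgt leqn0 => /eqP->.
have cA : #|A|%:R <= prs Q Q.
  rewrite -eA -sum1_card natr_sum; apply: ler_sum => u.
  rewrite inE => /andP[uQ h]; rewrite dA // degin_nat ler1n //.
have g2 : 0 <= t - K by rewrite subr_ge0.
have e_ge0 : 0 <= prs Q Q by apply: npairs_ge0.
have m_ge0 := ler0n R miss.
have [A0|A0] := posnP #|A|.
  have e0 : prs Q Q = 0.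
    rewrite -eA /npairs big1 // => u; move/eqP: A0; rewrite cards_eq0 => /eqP->.
    by rewrite inE.
  by rewrite e0 mulr0 addr_ge0 // mulr_ge0.
have hW := @bounded (L :|: A).
have cW : #|L :|: A|%:R = K + #|A|%:R :> R.
  by rewrite cardsU disjoint_setI0 // cards0 subn0 cL natrD.
have A1 : 1 <= #|A|%:R :> R by rewrite ler1n.
have {}hW : prs (L :|: A) (L :|: A) <= 2 * (t * (K + #|A|%:R) + r).
  by rewrite -cW; apply: hW; rewrite cW; move: tk A1; lra.
rewrite npairsUU // eA in hW.
have lb : K * (K - 1) + 2 * (K * #|A|%:R) - 2 * miss%:R <= prs L L + 2 * prs L A.
  have -> : K * (K - 1) + 2 * (K * #|A|%:R) - 2 * miss%:R =
     \sum_(l in L) (K - 1 + 2 * #|A|%:R - 2 * (nonadj l)%:R).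
    rewrite big_split /= sumr_const cL sumrN -mulr_sumr -natr_sum -mulr_natl; ring.
  rewrite /npairs mulr_sumr -big_split /=; apply: ler_sum => l lL.
  have h1 := degin_nonadj (L :|: A) l; have h2 := degin_nonadj A l.
  rewrite deginU // cW inE lL /= in h1.
  have lA : l \in A = false by apply/negbTE; rewrite (disjointFr dLA).
  rewrite lA in h2; move: h1 h2; rewrite addr0; lra.
have bin : 2 * 'C(k, 2)%:R = K * (K - 1).
  exact: natr_bin2.
rewrite /g0 /t0; have := ler_wpM2l g2 cA.
move: hW lb bin; lra.
Qed.

End Excess.

(** In the join of [K_k] with a triangle and isolated vertices, the eigenvector
    for [mu] with value [1] on the core has value [al] at an isolated vertex and
    [al + 2 * be] on the triangle; [muE] is the equation at the core. *)
Variables (al be : R).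
Hypotheses (mu_ge4 : 4 <= mu) (al_le1 : al <= 1) (mu_al : mu * al = K)
  (mu_be : be * (mu - 2) = al) (muE : mu = K - 1 + (n - K) * al + 6 * be).
Hypothesis k_gt0 : (0 < k)%N.
Hypotheses (x_core : {in L, forall v, 1 / 2 <= x v}).

Let K1 : 1 <= K. Proof. by rewrite ler1n. Qed.
Let mu_gt0 : 0 < mu. Proof. exact: lt_le_trans mu_ge4. Qed.
Let al_gt0 : 0 < al.
Proof. by rewrite -(pmulr_rgt0 _ mu_gt0) mu_al (lt_le_trans ltr01). Qed.
Let be_gt0 : 0 < be.
Proof.
have h : 0 < mu - 2 by rewrite subr_gt0 (lt_le_trans _ mu_ge4) // ltr_nat.
by rewrite -(pmulr_lgt0 _ h) mu_be.
Qed.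

Section Missing.
Hypotheses (x_rest : forall v, v \notin L -> x v <= 1 / 50).
Hypothesis few : (0 < miss)%N -> prs Q Q <= 12 * miss%:R.

(** Duality with [y = 1] on the core and [y = al] elsewhere: measured
    against [mu * (x . y)], a pair missing at the core lowers [x . A y] by at
    least [al / 2], while an ordered pair of adjacent vertices outside the core
    raises it by at most [al / 50]. *)
Lemma core_dominates l v : l \in L -> v != l -> adj l v.
Proof.
have [m0|m_gt0] := posnP miss.
  move=> lL vl; move/eqP: m0; rewrite sum_nat_eq0 => /forallP/(_ l).
  rewrite lL cards_eq0 => /eqP/setP/(_ v); rewrite !inE vl /=.
  by move/negbFE.
pose y v := if v \in L then 1 else al.
have y_ge0 u : 0 <= y u by rewrite /y; case: ifP => _ //; exact: ltW.
have Ay u : \sum_w a u w * y w = deg L u + al * deg Q u.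
  rewrite sum_split /degin mulr_sumr; congr (_ + _); apply: eq_bigr => w.
    by rewrite /y => ->; rewrite mulr1.
  by rewrite /y inE => /negPf ->; rewrite mulrC.
have m1 : 1 <= miss%:R :> R by rewrite ler1n.
have := subvector_duality y_ge0; rewrite !sum_split.
have hL : \sum_(v in L) x v * (\sum_u a v u * y u) <=
   mu * (\sum_(v in L) x v * y v) - 1 / 2 * al * miss%:R.
  rewrite /miss natr_sum mulr_sumr mulr_sumr -sumrB; apply: ler_sum => w wL.
  rewrite Ay /y wL mulr1.
  have h1 := deginT_nonadj w; rewrite -(setUCr L) deginU in h1; last first.
    by rewrite disjoints_subset setCK.
  have h2 : deg L w <= K - 1.
    have h := degin_nonadj L w.
    have -> : deg L w = deg (L :\ w) w.
      by rewrite /degin (big_setD1 w wL) /= adj_irr add0r.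
    apply: le_trans (degin_le_card _ _ _) _.
    by rewrite cL1.
  have h3 : deg L w + al * deg Q w <= mu - al * (nonadj w)%:R.
    have e : al * (deg L w + deg Q w + 1 + (nonadj w)%:R) = al * n by rewrite h1.
    have g : 0 <= (1 - al) * (K - 1 - deg L w) by rewrite mulr_ge0 // subr_ge0.
    have b0 := be_gt0.
    by move: e g b0 muE; lra.
  apply: le_trans (ler_wpM2l (x_ge0 w) h3) _.
  have := ler_wpM2r (mulr_ge0 (ltW al_gt0) (ler0n R (nonadj w))) (x_core wL).
  lra.
have hQ : \sum_(v in Q) x v * (\sum_u a v u * y u) <=
   mu * (\sum_(v in Q) x v * y v) + 1 / 50 * al * prs Q Q.
  rewrite /npairs mulr_sumr mulr_sumr -big_split; apply: ler_sum => u uQ /=.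
  have uL : u \notin L by rewrite inE in uQ.
  rewrite Ay /y (negPf uL) mulrDr; apply: lerD.
    rewrite mulrCA mu_al; apply: ler_wpM2l => //.
    by rewrite -cL degin_le_card.
  rewrite mulrA; apply: ler_wpM2r; first exact: degin_ge0.
  by apply: ler_wpM2r (x_rest uL); exact: ltW.
have h := ler_wpM2l (ltW al_gt0) (few m_gt0).
have h' : 0 < al * miss%:R by rewrite mulr_gt0 // (lt_le_trans ltr01).
by move: hL hQ h h'; lra.
Qed.
End Missing.

Section Dominated.
Hypothesis dom : forall l v, l \in L -> v != l -> adj l v.

Let degL l : l \in L -> deg L l = K - 1.
Proof.
move=> lL; rewrite /degin (big_setD1 l lL) /= adj_irr add0r.
rewrite (eq_bigr (fun=> 1)); last first.
  by move=> v; rewrite !inE => /andP[vl _]; rewrite dom.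
by rewrite sumr_const cL1.
Qed.

Let degLQ u : u \in Q -> deg L u = K.
Proof.
rewrite inE => uL; rewrite /degin (eq_bigr (fun=> 1)) ?sumr_const ?cL // => v vL.
by rewrite adj_sym dom //; apply: contraNneq uL => ->.
Qed.

(** Duality for [y = 1] on the core and [y = h] outside.  The inequality at the
    core must fail, because [x] does not vanish there. *)
Lemma super_rest (h : G -> R) :
    (forall u, u \in Q -> 0 <= h u) ->
    (forall u, u \in Q -> K + \sum_(v in Q) a u v * h v <= mu * h u) ->
  mu <= K - 1 + \sum_(v in Q) h v.
Proof.
move=> h_ge0 h_super; rewrite leNgt; apply/negP => lt_mu.
pose y v := if v \in L then 1 else h v.
have y_ge0 u : 0 <= y u.
  by rewrite /y; case: (boolP (u \in L)) => // uL; apply: h_ge0; rewrite inE.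
have Ay u : \sum_w a u w * y w = deg L u + \sum_(w in Q) a u w * h w.
  rewrite sum_split /degin; congr (_ + _); apply: eq_bigr => w.
    by rewrite /y => ->; rewrite mulr1.
  by rewrite /y inE => /negPf ->.
have := subvector_duality y_ge0; rewrite !sum_split.
set s := \sum_(v in Q) h v in lt_mu *.
have hL : \sum_(v in L) x v * (\sum_u a v u * y u) =
    (K - 1 + s) * \sum_(v in L) x v * y v.
  rewrite mulr_sumr; apply: eq_bigr => l lL.
  rewrite Ay /y lL degL // mulr1 mulrC; congr ((_ + _) * _).
  apply: eq_bigr => v; rewrite inE => vL; rewrite dom ?mul1r //.
  by apply: contraNneq vL => ->.
have hQ : \sum_(v in Q) x v * (\sum_u a v u * y u) <= mu * \sum_(v in Q) x v * y v.
  rewrite mulr_sumr; apply: ler_sum => u uQ.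
  rewrite Ay degLQ // mulrCA ler_wpM2l // /y.
  by move: (h_super u uQ); move: uQ; rewrite inE => /negPf ->.
have L_gt0 : 0 < \sum_(v in L) x v * y v.
  have [l lL] : exists l, l \in L by apply/card_gt0P; rewrite cL.
  rewrite (big_setD1 l lL) /= ltr_pwDl //.
    by rewrite /y lL mulr1 (lt_le_trans _ (x_core lL)) // divr_gt0.
  by apply: sumr_ge0 => v _; rewrite mulr_ge0.
rewrite hL mulrDr; apply/negP; rewrite -ltNge.
apply: le_lt_trans (lerD (lexx _) hQ) _; rewrite ltrD2r ltr_pM2r //.
Qed.

Hypothesis few : prs Q Q <= 6.

(** A vertex [c] with three neighbours outside the core is the centre of a claw
    that contains all three edges.  The test vector solves the eigenvector
    equations outside the core exactly; the claw then loses against the triangle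
    because [6 * (mu ^+ 2 - 3) > (6 * mu + 12) * (mu - 2)]. *)
Lemma rest_degree_le2 c : c \in Q -> deg Q c <= 2.
Proof.
move=> cQ; rewrite leNgt; apply/negP => dc2.
have dc3 : 3 <= deg Q c.
  by move: dc2; rewrite degin_nat ltr_nat ler_nat.
have dE u : u \in Q -> deg Q u = 3 * (u == c)%:R + a c u.
  (* The right-hand side is a lower bound whose sum is already at least 6. *)
  have f_ge0 w : w \in Q -> 0 <= deg Q w - (3 * (w == c)%:R + a c w).
    move=> wQ; rewrite subr_ge0; case: (eqVneq w c) => [->|wc].
      by rewrite adj_irr addr0 mulr1.
    rewrite mulr0 add0r; case cw: (adj c w); last exact: degin_ge0.
    rewrite /degin (big_setD1 c cQ) /= adj_sym cw lerDl.
    by apply: sumr_ge0 => z _; exact: ler0n.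
  move=> uQ; apply/eqP; rewrite -subr_eq0 eq_le f_ge0 // andbT.
  have : \sum_(w in Q) (deg Q w - (3 * (w == c)%:R + a c w)) <= 0.
    rewrite sumrB big_split /= -/(npairs R Q Q) -mulr_sumr -/(degin R Q c).
    rewrite (bigD1 c cQ) /= eqxx big1 ?addr0 ?mulr1.
      by move: few dc3; lra.
    by move=> w /andP[_ /negPf->].
  apply: le_trans; rewrite (big_setD1 u uQ) /= lerDl.
  by apply: sumr_ge0 => w; rewrite in_setD => /andP[_ /f_ge0].
have dc : deg Q c = 3 by rewrite dE // eqxx adj_irr addr0 mulr1.
have m4 := mu_ge4; have m0 := mu_gt0; have a0 := al_gt0.
have P_gt0 : 0 < mu ^+ 2 - 3 by rewrite expr2; nra.
pose D := al / (mu ^+ 2 - 3).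
have D_gt0 : 0 < D by rewrite divr_gt0.
have alE : al = D * (mu ^+ 2 - 3) by rewrite /D divfK // gt_eqF.
clearbody D.
(* [al + A] and [al + B] solve [mu * hc = k + 3 * hl] and [mu * hl = k + hc],
   the equations for the values at the centre and at a leaf. *)
pose A := D * (3 * mu + 3); pose B := D * (mu + 3).
have A_gt0 : 0 < A by rewrite mulr_gt0 // ltr_wpDl // mulr_ge0 // ltW.
have B_gt0 : 0 < B by rewrite mulr_gt0 // ltr_wpDl // ltW.
have [AE BE] : A = D * (3 * mu + 3) /\ B = D * (mu + 3) by [].
clearbody A B.
pose h u := al + A * (u == c)%:R + B * a c u.
have h_ge0 u : u \in Q -> 0 <= h u.
  by move=> _; rewrite !addr_ge0 ?mulr_ge0 ?ler0n ?(ltW A_gt0) ?(ltW B_gt0) ?(ltW a0).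
have hc : h c = al + A by rewrite /h eqxx adj_irr mulr0 addr0 mulr1.
have h_super u : u \in Q -> K + \sum_(v in Q) a u v * h v <= mu * h u.
  move=> uQ; case: (eqVneq u c) => [->|uc].
    have -> : \sum_(v in Q) a c v * h v = (al + B) * deg Q c.
      rewrite mulr_sumr; apply: eq_bigr => v vQ.
      case: (eqVneq v c) => [->|/negPf vc]; first by rewrite adj_irr mul0r mulr0.
      by rewrite /h vc; case: adj; rewrite ?mul0r ?mulr0 ?mul1r ?mulr1 ?addr0.
    rewrite hc dc -mu_al alE AE BE le_eqVlt; apply/orP; left; apply/eqP; ring.
  have -> : \sum_(v in Q) a u v * h v = a c u * (al + A).
    rewrite (big_setD1 c cQ) /= hc adj_sym big1 ?addr0 // => v vQ.
    have : \sum_(w in Q :\ c) a u w = 0.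
      have := dE u uQ; rewrite /degin (big_setD1 c cQ) /= (negPf uc) mulr0 add0r adj_sym.
      by move/(congr1 (fun z => z - a c u)); rewrite addrAC subrr add0r.
    by move/psumr_eq0P => -> //; rewrite mul0r.
  rewrite /h (negPf uc) mulr0 addr0 [mu * _]mulrDr mu_al lerD2l mulrA [leRHS]mulrC.
  rewrite ler_wpM2l ?ler0n // alE AE BE le_eqVlt; apply/orP; left; apply/eqP; ring.
have := super_rest h_ge0 h_super.
rewrite !big_split /= -!mulr_sumr sumr_const -[al *+ _]mulr_natr cardQ -/(degin R Q c) dc.
rewrite (bigD1 c cQ) /= eqxx big1 ?addr0 ?mulr1; last by move=> w /andP[_ /negPf->].
rewrite {1}muE => H.
have {}H : 6 * be <= A + B * 3 by move: H; lra.
have m2 : 0 < mu - 2 by rewrite subr_gt0 (lt_le_trans _ mu_ge4) // ltr_nat.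
rewrite -(ler_pM2r m2) -mulrA mu_be alE AE BE in H.
have : 0 < D * 6 by rewrite mulr_gt0.
by move: H; rewrite expr2; lra.
Qed.

(** With maximal degree two, [al + be * deg] is a test vector, with the sum of
    its values at most that of the triangle.  Its slack at [u] is [be * q u],
    where [q u] vanishes everywhere only if all neighbours of each vertex have
    average degree two; subtracting [be * q u / mu] moves the slack to the core.
    Duality thus leaves three edges and the sum of [deg * (2 - deg)] equal to
    zero, that is, every degree equal to 0 or 2. *)
Lemma rest_triangle : exists T : {set G},
  [/\ T \subset Q, #|T| = 3%N &
      {in Q &, forall u v, adj u v = [&& u != v, u \in T & v \in T]}].
Proof.
pose q u := 2 * deg Q u - \sum_(v in Q) a u v * deg Q v.
have m4 := mu_ge4; have m0 := mu_gt0; have a0 := al_gt0; have b0 := be_gt0.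
have d2 := rest_degree_le2.
have q_ge0 u : u \in Q -> 0 <= q u.
  move=> uQ; rewrite subr_ge0 mulr_sumr; apply: ler_sum => v vQ.
  by rewrite mulrC ler_wpM2r ?ler0n ?d2.
have q_le u : q u <= 2 * deg Q u.
  by rewrite gerBl; apply: sumr_ge0 => v _; rewrite mulr_ge0 ?ler0n ?degin_ge0.
pose i := mu^-1; have mui : mu * i = 1 by rewrite /i divff // gt_eqF.
have i_gt0 : 0 < i by rewrite invr_gt0.
have i_le : i * 2 <= 1.
  by have := ler_wpM2r (ltW i_gt0) m4; rewrite mui; move: i_gt0; lra.
clearbody i.
pose h u := al + be * (deg Q u - i * q u).
have h_ge0 u : u \in Q -> 0 <= h u.
  move=> uQ; rewrite addr_ge0 ?mulr_ge0 ?(ltW a0) ?(ltW b0) // subr_ge0.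
  apply: le_trans (ler_wpM2l (ltW i_gt0) (q_le u)) _.
  by rewrite mulrA ler_piMl ?degin_ge0.
have h_super u : u \in Q -> K + \sum_(v in Q) a u v * h v <= mu * h u.
  move=> uQ.
  have -> : mu * h u = mu * al + be * (mu - 2) * deg Q u + be * (2 * deg Q u) - be * (mu * i) * q u.
    by rewrite /h; ring.
  rewrite mui mu_al mu_be -addrA -addrA lerD2l mulr1.
  have -> : be * (2 * deg Q u) - be * q u = be * \sum_(v in Q) a u v * deg Q v.
    by rewrite /q; ring.
  rewrite /degin 2!mulr_sumr -big_split; apply: ler_sum => v vQ /=.
  rewrite /h mulrDr [al * _]mulrC lerD2l mulrCA ler_wpM2l ?(ltW b0) //.
  rewrite ler_wpM2l ?ler0n // gerBl mulr_ge0 ?(ltW i_gt0) ?q_ge0 //.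
have := super_rest h_ge0 h_super.
rewrite !big_split /= sumr_const -[al *+ _]mulr_natr cardQ -mulr_sumr sumrB -/(npairs R Q Q) -mulr_sumr.
rewrite {1}muE => H.
have {}H : be * 6 <= be * (prs Q Q - i * \sum_(u in Q) q u) by move: H; lra.
rewrite ler_pM2l // in H.
have sq_ge0 : 0 <= i * \sum_(u in Q) q u.
  by rewrite mulr_ge0 ?(ltW i_gt0) // sumr_ge0.
have e6 : prs Q Q = 6 by move: H sq_ge0 few; lra.
have q0 : \sum_(u in Q) q u <= 0.
  by rewrite -(ler_pM2l i_gt0) mulr0; move: H e6; lra.
have qE : \sum_(u in Q) q u = \sum_(u in Q) deg Q u * (2 - deg Q u).
  rewrite sumrB exchange_big /= -mulr_sumr.
  under [RHS]eq_bigr do rewrite mulrBr.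
  rewrite sumrB -mulr_suml mulrC; congr (_ - _); apply: eq_bigr => v vQ.
  by rewrite -mulr_suml; congr (_ * _); apply: eq_bigr => u _; rewrite adj_sym.
have d02 u : u \in Q -> deg Q u * (2 - deg Q u) = 0.
  have f_ge0 w : w \in Q -> 0 <= deg Q w * (2 - deg Q w).
    by move=> wQ; rewrite mulr_ge0 ?degin_ge0 // subr_ge0 d2.
  move: u; apply: psumr_eq0P => //.
  by apply/eqP; rewrite eq_le -{1}qE q0 sumr_ge0.
pose N u := [set v in Q | adj u v].
pose T := [set u in Q | N u != set0].
have sTQ : T \subset Q by apply/subsetP => u; rewrite inE => /andP[].
have N2 u : u \in T -> #|N u| = 2%N.
  rewrite inE => /andP[uQ]; rewrite -cards_eq0 -(eqr_nat R) -degin_nat => du.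
  have := d02 u uQ; move/eqP; rewrite mulf_eq0 (negPf du) /= subr_eq0 eq_sym.
  by rewrite degin_nat eqr_nat => /eqP.
have cT : #|T| = 3%N.
  apply/eqP; rewrite -(eqr_nat R) -(inj_eq (mulfI (_ : 2 != 0 :> R))) ?pnatr_eq0 //.
  rewrite -[2 * 3%:R]natrM -[6%:R]e6 /npairs (big_setID T) /= (setIidPr sTQ).
  rewrite [X in _ + X]big1 ?addr0; last first.
    move=> u; rewrite in_setD inE => /andP[nT uQ]; move: nT; rewrite uQ /= negbK => /eqP nu.
    by rewrite degin_nat -/(N u) nu cards0.
  rewrite (eq_bigr (fun=> 2)) ?sumr_const ?mulr_natr // => u uT.
  by rewrite degin_nat -/(N u) N2.
exists T; split=> // u v uQ vQ.
case: (boolP (u \in T)) => uT; last first.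
  rewrite andbF; apply/negbTE; apply: contra uT => uv.
  by rewrite inE uQ; apply/set0Pn; exists v; rewrite inE vQ.
have NT : N u = T :\ u.
  apply/eqP; rewrite eqEcard N2 // [_.+1]/= -ltnS.
  rewrite (_ : #|T :\ u|.+1 = 3)%N ?andbT; last by rewrite -cT (cardsD1 u T) uT.
  apply/subsetP => w; rewrite !inE => /andP[wQ uw].
  rewrite wQ; apply/andP; split; first by apply: contraTneq uw => ->; rewrite adj_irr.
  by apply/set0Pn; exists u; rewrite inE uQ adj_sym.
have : (v \in N u) = (v \in T :\ u) by rewrite NT.
by rewrite [v \in N u]inE vQ in_setD1 /= => ->; rewrite eq_sym.
Qed.

End Dominated.
End Endgame.

(** * The extremal graph *)

(** The extremal graph described inside [G], which spares isomorphisms until the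
    very end: [L] is the dominating clique and [T] the triangle. *)
Definition core_triangle (G : sgraph) (L T : {set G}) : Prop :=
  [/\ [disjoint L & T], #|T| = 3%N & forall u v, adj u v =
     (u != v) && [|| u \in L, v \in L | (u \in T) && (v \in T)]].

Definition triangle_join k q := gjoin (complete k) (gunion (complete 3) (copies (complete 1) q)).

Lemma card_triangle_join k q : #|triangle_join k q| = (k + (3 + q))%N.
Proof. by rewrite !card_sum card_prod !card_ord muln1. Qed.

Lemma triangle_join_core k q :
  exists L T : {set triangle_join k q}, #|L| = k /\ core_triangle L T.
Proof.
pose L : {set triangle_join k q} := [set inl i | i in [set: 'I_k]].
pose T : {set triangle_join k q} := [set inr (inl i) | i in [set: 'I_3]].
have LE (u : triangle_join k q) : (u \in L) = if u is inl _ then true else false.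
  apply/imsetP/idP => [[i _ ->]//|]; case: u => // i _; exists i; rewrite ?inE //.
have TE (u : triangle_join k q) : (u \in T) = if u is inr (inl _) then true else false.
  apply/imsetP/idP => [[i _ ->]//|]; case: u => [//|[]//] i _; exists i; rewrite ?inE //.
exists L, T; split; first by rewrite card_imset ?cardsT ?card_ord //; exact: inl_inj.
split.
- rewrite -setI_eq0; apply/eqP/setP => u; rewrite !inE LE TE.
  by case: u.
- by rewrite card_imset ?cardsT ?card_ord // => i j [].
move=> u v; rewrite !LE !TE.
case: u => [i|[i|[i i']]]; case: v => [j|[j|[j j']]] //=; rewrite ?andbF ?andbT //.
by rewrite /copies_rel /= /complete_rel !ord1 eqxx andbF.
Qed.

(** Enumerating [L], [T] and the remaining vertices maps the join into [G]. *)
Lemma core_triangle_giso (G : sgraph) (L T : {set G}) : core_triangle L T ->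
  giso G (triangle_join #|L| (#|G| - #|L| - 3)).
Proof.
move=> [dLT cT adjE]; pose S := ~: (L :|: T).
have cS : (#|G| - #|L| - 3)%N = #|S|.
  by rewrite -(cardsC (L :|: T)) cardsU disjoint_setI0 // cards0 subn0 cT -subnDA addKn.
rewrite cS.
pose g (a : triangle_join #|L| #|S|) : G := match a with
  | inl i => enum_val i
  | inr (inl j) => enum_val (cast_ord (esym cT) j)
  | inr (inr (i, _)) => enum_val i
  end.
have gL i : g (inl i) \in L by exact: enum_valP.
have gT j : g (inr (inl j)) \in T by exact: enum_valP.
have gS p : g (inr (inr p)) \in S by case: p => i i'; exact: enum_valP.
have TL v : v \in T -> (v \in L) = false by move=> vT; apply: (disjointFl dLT).
have SL v : v \in S -> (v \in L) = false by rewrite !inE negb_or => /andP[/negPf].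
have ST v : v \in S -> (v \in T) = false by rewrite !inE negb_or => /andP[_ /negPf].
have g_inj : injective g.
  move=> [i|[i|[i i']]] [j|[j|[j j']]] //= E.
  - by rewrite (enum_val_inj E).
  - by have := gL i; rewrite /= E (TL _ (gT j)).
  - by have := gL i; rewrite /= E (SL _ (gS (j, j'))).
  - by have := gL j; rewrite /= -E (TL _ (gT i)).
  - by rewrite (cast_ord_inj (enum_val_inj E)).
  - by have := gT i; rewrite /= E (ST _ (gS (j, j'))).
  - by have := gL j; rewrite /= -E (SL _ (gS (i, i'))).
  - by have := gT j; rewrite /= -E (ST _ (gS (i, i'))).
  - by rewrite (enum_val_inj E) !ord1.
have [f gK fK] : bijective g.
  apply: inj_card_bij g_inj _; rewrite card_triangle_join -cS.
  by lia.
exists f; first by exists g.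
suff H a b : adj (g a) (g b) = adj a b by move=> x y; rewrite -H !fK.
rewrite adjE (inj_eq g_inj).
case: a => [i|[i|[i i']]]; case: b => [j|[j|[j j']]];
  rewrite ?gL ?gT ?(TL _ (gT _)) ?(SL _ (gS _)) ?(ST _ (gS _)) ?orbT ?andbT ?andbF //=.
by rewrite /copies_rel /= /complete_rel !ord1 eqxx andbF.
Qed.

Section CoreTriangle.
Variables (R : realType) (G : sgraph) (L T : {set G}).
Hypothesis form : core_triangle L T.
Local Notation k := #|L|.
Local Notation K := (#|L|%:R : R).

(** A vertex set that omits [j] vertices of the clique and contains [w] vertices
    outside it has [w >= j] by the lower bound on its size.  Apart from the
    triangle edges, it stays below the bound by at least
    [g0 + j * w - j * (j + 1) / 2], so the case [j = 0] is the tight one, where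
    the three triangle edges require [3 * (K + 1 - t) <= g0]. *)
Lemma core_triangle_bounded (t r : R) :
    let g0 := t * K + r - 'C(k, 2)%:R in
    K <= t -> 2 <= g0 -> 3 * (K + 1 - t) <= g0 ->
  hereditarily_bounded t r G.
Proof.
move=> g0 kt g2 g3; apply/hereditarily_boundedE => W tW.
have [dLT cT adjE] := form.
pose i := #|W :&: L|; pose w := #|W :\: L|; pose b := #|W :&: T|.
have bT : (b <= 3)%N by rewrite -cT subset_leq_card // subsetIr.
have bw : (b <= w)%N.
  apply/subset_leq_card/subsetP => u; rewrite !inE => /andP[-> uT].
  by rewrite (disjointFl dLT).
have iL : (i <= k)%N by rewrite subset_leq_card // subsetIr.
have cW : #|W| = (i + w)%N by rewrite -(cardsID L W).
have dW u : degin R W u <= if u \in L then #|W :\ u|%:R else i%:R + (u \in T)%:R * #|(W :&: T) :\ u|%:R.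
  rewrite degin_nat; case: ifP => uL.
    rewrite ler_nat subset_leq_card //; apply/subsetP => v.
    by rewrite !inE adjE eq_sym => /andP[-> /andP[->]].
  rewrite -natrM -natrD ler_nat; case: (boolP (u \in T)) => uT /=.
    rewrite mul1n; apply: leq_trans (_ : #|(W :&: L) :|: ((W :&: T) :\ u)| <= _)%N; last first.
      by rewrite cardsU leq_subr.
    apply/subset_leq_card/subsetP => v; rewrite !inE adjE uL uT /= eq_sym.
    by case: (v \in W) => //=; case: (v == u).
  rewrite mul0n addn0; apply/subset_leq_card/subsetP => v.
  by rewrite !inE adjE uL (negPf uT) /= orbF => /and3P[-> _ ->].
have le1 : npairs R W W <= (i * (i + w).-1 + (w * i + b * b.-1))%N%:R.
  rewrite /npairs (big_setID L) /= natrD; apply: lerD.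
    rewrite natrM mulr_natl -sumr_const; apply: ler_sum => u.
    rewrite inE => /andP[uW uL]; apply: le_trans (dW u) _; rewrite uL -cW.
    by rewrite (cardsD1 u W) uW.
  apply: le_trans (_ : \sum_(u in W :\: L) (i%:R + (u \in T)%:R * b.-1%:R) <= _).
    apply: ler_sum => u; rewrite inE => /andP[/negPf uL uW].
    apply: le_trans (dW u) _; rewrite uL lerD2l.
    by case: (boolP (u \in T)) => uT; rewrite ?mul0r // /b (cardsD1 u (W :&: T)) inE uW uT.
  rewrite big_split /= sumr_const -[i%:R *+ _]mulr_natl natrD natrM lerD2l -mulr_suml.
  rewrite natrM ler_wpM2r ?ler0n // -natr_sum ler_nat.
  rewrite (eq_bigr (fun u => if u \in T then 1%N else 0%N)); last by move=> u _; case: ifP.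
  rewrite -big_mkcondr sum1dep_card subset_leq_card //.
  by apply/subsetP => u; rewrite !inE => /andP[/andP[_ ->] ->].
apply: le_trans le1 _.
have iw : K <= i%:R + w%:R by rewrite -natrD -cW; lra.
have bin := natr_bin2 R k.
rewrite cW [in leRHS]natrD.
have g0E : r = g0 - t * K + 'C(k, 2)%:R by rewrite /g0; ring.
clearbody g0; rewrite g0E {g0E}.
move: iL iw kt g3 g2 bin bT bw; clearbody i w b; move: 'C(k,2)%:R => C.
clear; move: k => k iL; rewrite -natrD ler_nat -(subnKC iL).
set j := (k - i)%N; rewrite leq_add2l !natrD => jw kt g3 g2 bin bT bw.
have e1 (p q : nat) : (p * (p + q).-1)%:R + (q * p)%:R
    = p%:R * (p%:R - 1) + 2 * p%:R * q%:R :> R.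
  case: p => [|p]; first by rewrite mul0n muln0; ring.
  by rewrite addSn /= !natrM natrD -(natr1 p); ring.
rewrite addrA e1.
have tw : 0 <= (t - (i%:R + j%:R)) * (w%:R - j%:R).
  by rewrite mulr_ge0 // subr_ge0 // ler_nat.
suff : (b * b.-1)%:R + j%:R * j%:R + j%:R <=
    2 * j%:R * w%:R + 2 * g0 + 2 * ((t - (i%:R + j%:R)) * (w%:R - j%:R)).
  by move: bin; lra.
have [j0|j_gt0] := posnP j.
  rewrite j0 !mulr0 !addr0 !mul0r subr0 add0r in tw g3 kt *.
  have [b3|b2] := eqVneq b 3%N; last first.
    have : (b * b.-1)%:R <= 2 :> R by rewrite (ler_nat _ _ 2); move: bT b2; clear; case: b => [|[|[|[]]]].
    by move: tw g2; lra.
  have w3 : 3 <= w%:R :> R by rewrite ler_nat -b3.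
  have : 0 <= (t - i%:R) * (w%:R - 3) by rewrite mulr_ge0 ?subr_ge0.
  by rewrite b3 -[(_ * _)%:R]/(6%:R); move: g3; lra.
have : (b * b.-1 + j * j + j <= 2 * j * w + 4)%N.
  move: bT bw; case: b => [|[|[|[|//]]]] _ bw /=; nia.
rewrite -(ler_nat R) !natrD !natrM; move: tw g2; lra.
Qed.

Lemma core_triangle_eigenvalue (mu al be : R) :
    0 < K ->
    mu * al = K -> be * (mu - 2) = al -> mu = K - 1 + (#|G|%:R - K) * al + 6 * be ->
  mu <= rho R G.
Proof.
have [dLT cT adjE] := form.
move=> K_gt0 mu_al mu_be muE.
have TL v : v \in T -> v \notin L by move=> vT; rewrite (disjointFl dLT).
pose z v : R := if v \in L then 1 else al + 2 * be * (v \in T)%:R.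
have [l lL] : exists l, l \in L by apply/card_gt0P; rewrite -(ltr0n R).
have G_gt0 : (0 < #|G|)%N by apply/card_gt0P; exists l.
apply: (@eigenvector_le_rho R G G_gt0 mu z l); first by rewrite /z lL oner_neq0.
have cL l' : l' \in L -> #|L :\ l'|%:R = K - 1.
  by move=> l'L; rewrite (cardsD1 l' L) l'L add1n -[in RHS]natr1 addrK.
have sQ : \sum_(v in ~: L) z v = (#|G|%:R - K) * al + 6 * be.
  rewrite (eq_bigr (fun v => al + 2 * be * (v \in T)%:R)); last first.
    by move=> v; rewrite inE /z => /negPf ->.
  rewrite big_split /= sumr_const -[al *+ _]mulr_natl -mulr_sumr; congr (_ * _ + _).
    by rewrite -(cardsC L) natrD addrC addKr.
  rewrite -natr_sum (eq_bigr (fun u => if u \in T then 1%N else 0%N)); last by move=> u _; case: ifP.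
  rewrite -big_mkcondr sum1dep_card (_ : #|_| = 3%N); first by ring.
  rewrite -cT; apply: eq_card => u; rewrite !inE.
  by case: (boolP (u \in T)) => [/TL ->|]; rewrite ?andbF.
have sum_split (F : G -> R) : \sum_v F v = \sum_(v in L) F v + \sum_(v in ~: L) F v.
  by rewrite -sum_setU ?setUCr ?sum_setT // disjoints_subset setCK.
have sL v : v \notin L -> \sum_(u in L) z u * (adj u v)%:R = K.
  move=> vL; rewrite (eq_bigr (fun=> 1)) ?sumr_const // => u uL.
  rewrite /z uL mul1r adjE uL andbT.
  by case: eqVneq => // E; rewrite -E uL in vL.
move=> v; rewrite sum_split {3}/z.
case: (boolP (v \in L)) => vL.
  rewrite (big_setD1 v vL) /= adj_irr mulr0 add0r mulr1 muE -addrA -sQ; congr (_ + _).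
    rewrite -(cL v vL) -sumr_const; apply: eq_bigr => u; rewrite !inE => /andP[uv uL].
    by rewrite /z uL adjE uv uL mulr1.
  apply: eq_bigr => u; rewrite inE => uL.
  rewrite adjE vL orbT andbT; case: eqVneq => [E|_]; last by rewrite mulr1.
  by rewrite -E (negPf uL) in vL.
rewrite sL //; case: (boolP (v \in T)) => vT; last first.
  rewrite big1 ?addr0 ?mulr0 ?addr0 // => u; rewrite inE => uL.
  by rewrite adjE (negPf uL) (negPf vL) (negPf vT) !andbF mulr0.
rewrite (bigID (mem T)) /= [X in _ + (_ + X)]big1 ?addr0; last first.
  move=> u /andP[]; rewrite inE => uL uT.
  by rewrite adjE (negPf uL) (negPf vL) (negPf uT) !andbF mulr0.
have -> : \sum_(i in ~: L | i \in T) z i * (adj i v)%:R = \sum_(i in T :\ v) (al + 2 * be).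
  rewrite big_mkcond [RHS]big_mkcond; apply: eq_bigr => u _; rewrite !inE.
  case: (boolP (u \in T)) => uT; rewrite ?andbF // (TL _ uT) /= andbT.
  rewrite adjE (negPf (TL _ uT)) (negPf vL) uT vT /= andbT.
  by rewrite /z (negPf (TL _ uT)) uT mulr1; case: eqVneq; rewrite ?mulr0 ?mulr1.
have cTv : #|T :\ v| = 2%N by apply/eqP; rewrite -eqSS -cT (cardsD1 v T) vT.
rewrite sumr_const cTv -mu_al mulr1 mulrDr.
have -> : mu * (2 * be) = 2 * (be * (mu - 2)) + 4 * be by ring.
rewrite mu_be; ring.
Qed.
End CoreTriangle.

(** Clearing denominators in the equation for [mu] gives a cubic, nonpositive at
    the square root of [K * m] and nonnegative at that root plus [7 * K]. *)
Lemma triangle_join_eigenvalue_exists (R : realType) (K m : R) :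
    1 <= K -> K <= m -> 16 <= m ->
  exists mu al be : R, [/\ 4 <= mu, al <= 1, K * m <= mu ^+ 2,
    mu * al = K & be * (mu - 2) = al /\ mu = K - 1 + m * al + 6 * be].
Proof.
move=> K1 Km m16.
have Km16 : 16 <= K * m by nra.
pose s := Num.sqrt (K * m).
have sE : s ^+ 2 = K * m by rewrite sqr_sqrtr //; lra.
have s0 : 0 <= s by apply: sqrtr_ge0.
have s4 : 4 <= s.
  rewrite -(@ler_pXn2r _ 2) ?nnegrE // sE (_ : 4 ^+ 2 = 16) //; ring.
have sK : K <= s.
  rewrite -(@ler_pXn2r _ 2) ?nnegrE //; last lra.
  by rewrite sE expr2 ler_wpM2l //; lra.
clearbody s.
pose p : {poly R} := 'X * ('X - 2%:P) * ('X - (K - 1)%:P) - (K * m) *: ('X - 2%:P) - (6 * K)%:P.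
have pE y : p.[y] = y * (y - 2) * (y - (K - 1)) - K * m * (y - 2) - 6 * K.
  by rewrite /p !hornerE.
have [||mu /andP[smu _] /rootP] := @poly_ivt R p s (s + 7 * K).
- lra.
- rewrite !pE -sE; apply/andP; split.
    have -> : s * (s - 2) * (s - (K - 1)) - s ^+ 2 * (s - 2) - 6 * K =
       - ((K - 1) * s * (s - 2) + 6 * K) by ring.
    rewrite oppr_le0 addr_ge0 //; last lra.
    by rewrite !mulr_ge0 //; lra.
  have -> : (s + 7 * K) * (s + 7 * K - 2) * (s + 7 * K - (K - 1)) - s ^+ 2 * (s + 7 * K - 2) - 6 * K
   = (s + 7 * K - 2) * (13 * s * K + 42 * K ^+ 2 + s + 7 * K) - 6 * K by ring.
  rewrite subr_ge0; apply: le_trans (_ : 1 * (7 * K) <= _); first lra.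
  apply: ler_pM; try lra.
  have h : 0 <= 13 * s * K by rewrite !mulr_ge0 //; lra.
  have := sqr_ge0 K; lra.
rewrite pE => mu0.
have mu4 : 4 <= mu by lra.
have mun : mu != 0 by rewrite gt_eqF //; lra.
have mu2n : mu - 2 != 0 by rewrite gt_eqF //; lra.
exists mu, (K / mu), (K / mu / (mu - 2)); split=> //.
- by rewrite ler_pdivrMr; lra.
- by rewrite -sE ler_pXn2r // nnegrE; lra.
- by rewrite mulrCA divff // mulr1.
split; first by rewrite divfK.
apply: (mulfI mun); apply: (mulfI mu2n).
have -> : (mu - 2) * (mu * (K - 1 + m * (K / mu) + 6 * (K / mu / (mu - 2)))) =
  mu * (mu - 2) * (K - 1) + K * m * (mu - 2) + 6 * K.
  by field; rewrite mun mu2n.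
by move: mu0; rewrite !mulrDr; lra.
Qed.

(** * The theorem *)

(** Sets with fewer than [t] vertices have at most [t ^+ 2] ordered pairs, so a
    larger constant removes the restriction on the size of [W]. *)
Lemma bounded_sparse (R : realType) (G : sgraph) (t r : R) : 0 <= t ->
    (forall W : {set G}, t <= #|W|%:R -> npairs R W W <= 2 * (t * #|W|%:R + r)) ->
  forall W : {set G}, npairs R W W <= 2 * (t * #|W|%:R + (`|r| + t ^+ 2)).
Proof.
move=> t0 bounded W; have w0 := ler0n R #|W|.
have rr := ler_norm r; have t2 := sqr_ge0 t; have r0 := normr_ge0 r.
have [tW|Wt] := leP t #|W|%:R.
  apply: le_trans (bounded W tW) _; rewrite ler_pM2l // lerD2l; lra.
apply: le_trans (npairs_le_card R W) _.
have := ler_wpM2r w0 (ltW Wt); have := mulr_ge0 t0 w0; lra.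
Qed.

Lemma extremal_core_triangle (R : realType) (G : sgraph) (t r : R) (k : nat)
    (mu al be : R) (x : G -> R) (L : {set G}) :
  let t0 := k%:R + 1 - t in
  let g0 := t * k%:R + r - 'C(k, 2)%:R in
    k%:R <= t -> 3 * t0 <= g0 < 8 * t0 - 4 -> (0 < k)%N ->
    (forall W : {set G}, t <= #|W|%:R -> npairs R W W <= 2 * (t * #|W|%:R + r)) ->
    mu <= rho R G -> (forall v, 0 <= x v) ->
    (forall v, rho R G * x v <= \sum_u (adj v u)%:R * x u) ->
    4 <= mu -> al <= 1 -> mu * al = k%:R -> be * (mu - 2) = al ->
    mu = k%:R - 1 + (#|G|%:R - k%:R) * al + 6 * be ->
    #|L| = k -> {in L, forall v, 1 / 2 <= x v} ->
    (forall v, v \notin L -> x v <= 1 / 50) ->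
  exists T : {set G}, core_triangle L T.
Proof.
move=> t0 g0 kt /andP[g3 g8] k_gt0 bounded mu_le x_ge0 sub mu4 al1 mu_al mu_be muE cL xL xQ.
have tk : t - k%:R <= 1 / 5 by move: g3 g8; rewrite /t0; lra.
have g_ge0 : 0 <= g0 by move: g3; rewrite /t0; move: tk; lra.
have e2 := npairs_rest cL kt tk g_ge0 bounded.
rewrite -/t0 -/g0 in e2.
set m := \sum_(l in L) nonadj l in e2.
have t5 : 3 / 5 <= 2 * t0 - 1 by rewrite /t0; move: tk; lra.
have few : (0 < m)%N -> npairs R (~: L) (~: L) <= 12 * m%:R.
  move=> m_gt0; rewrite leNgt; apply/negP => lt12.
  have m1 : 1 <= m%:R :> R by rewrite ler1n.
  have : 3 / 5 * (npairs R (~: L) (~: L) - 8) <= (2 * t0 - 1) * (npairs R (~: L) (~: L) - 8).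
    by rewrite ler_wpM2r // subr_ge0; move: m1 lt12; lra.
  by move: e2 g8 m1 lt12; lra.
have dom := core_dominates mu_le x_ge0 sub cL mu4 al1 mu_al mu_be muE k_gt0 xL xQ few.
have m0 : m = 0%N.
  apply: big1 => l lL; apply/eqP; rewrite cards_eq0; apply/eqP/setP => v.
  rewrite !inE; case: (eqVneq v l) => //= vl; by rewrite dom.
have e6 : npairs R (~: L) (~: L) <= 6.
  rewrite m0 mulr0 addr0 npairs_edges in e2 *.
  set E := #|_| in e2 *.
  (* The number of edges is an integer below 4. *)
  suff : (E <= 3)%N by rewrite -(ler_nat R); lra.
  rewrite leqNgt; apply/negP => E4.
  have {}E4 : 4 <= E%:R :> R by rewrite ler_nat.
  have : 0 <= (2 * t0 - 1) * (E%:R - 4).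
    by rewrite mulr_ge0 ?subr_ge0 //; move: t5; lra.
  by move: e2 g8; lra.
have [T [sT cT TE]] :=
  rest_triangle mu_le x_ge0 sub cL mu4 mu_al mu_be muE k_gt0 xL dom e6.
exists T; split=> //; first by rewrite disjoint_sym disjoints_subset.
move=> u v; case: (eqVneq u v) => [->|uv] /=; first by rewrite adj_irr.
case: (boolP (u \in L)) => uL; first by rewrite dom // eq_sym.
case: (boolP (v \in L)) => vL; first by rewrite adj_sym dom.
by rewrite TE ?inE // uv.
Qed.

Theorem theorem4p1 (R : realType) (t r : R) :
  1 <= t ->
  - 'C(Num.truncn (t + 1), 2)%:R <= r ->
  let k := Num.truncn t in
  let t0 := k%:R + 1 - t in
  let g0 := t * k%:R + r - 'C(k, 2)%:R in
  3 * t0 <= g0 < 8 * t0 - 4 ->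
  exists N : nat, forall n : nat, (N <= n)%N ->
  forall G : sgraph, max_rho_bounded t r n G ->
    giso G (gjoin (complete k)
                  (gunion (complete 3) (copies (complete 1) (n - k - 3)))).
Proof.
move=> t1 _ k t0 g0 g0_itv.
have t_ge0 : 0 <= t by lra.
have /andP[kt _] : k%:R <= t < k.+1%:R by apply: truncn_itv.
have k_gt0 : (0 < k)%N by rewrite truncn_gt0.
have /andP[g3 g8] := g0_itv.
have tk : t - k%:R <= 1 / 5 by move: g3 g8; rewrite /t0; lra.
have c_ge0 : 0 <= `|r| + t ^+ 2 by rewrite addr_ge0 // sqr_ge0.
have [N coreN] := core_exists kt tk k_gt0 c_ge0.
exists (N + (2 * k + 16))%N => n Nn G [Gn /hereditarily_boundedE Gb Gmax].
have K1 : 1 <= k%:R :> R by rewrite ler1n.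
have [|| mu [al [be [mu4 al1 mu_lb mu_al [mu_be muE]]]]] :=
  @triangle_join_eigenvalue_exists R k%:R (n%:R - k%:R) K1.
- by rewrite lerBrDr -natrD ler_nat; lia.
- by rewrite lerBrDr -natrD ler_nat; lia.
have [L0 [T0 [cL0 form0]]] := triangle_join_core k (n - k - 3).
have cF : #|triangle_join k (n - k - 3)| = n by rewrite card_triangle_join; clear -Nn; clearbody k; lia.
have mu_F : mu <= rho R (triangle_join k (n - k - 3)).
  apply: (core_triangle_eigenvalue form0 (al := al) (be := be));
  by rewrite ?cL0 ?cF ?(lt_le_trans ltr01).
have F_le : rho R (triangle_join k (n - k - 3)) <= rho R G.
  apply: Gmax => //; apply: (core_triangle_bounded form0); rewrite cL0 //.
  by move: g3; rewrite -/g0 /t0; move: tk; lra.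
have mu_G := le_trans mu_F F_le.
have G_gt0 : (0 < #|G|)%N by rewrite Gn (leq_trans _ Nn) // !addn_gt0 !orbT.
have [x [v0 [x01 xv0 sub]]] := rho_subeigenvector R G_gt0.
have x_ge0 v : 0 <= x v by case/andP: (x01 v).
have lam_gt0 : 0 < rho R G by move: mu_G mu4; lra.
have [||L [cL xL xQ]] := coreN G _ (bounded_sparse t_ge0 Gb) _ x v0 lam_gt0 x01 xv0 sub.
- by rewrite Gn (leq_trans (leq_addr _ _) Nn).
- rewrite Gn; apply: le_trans mu_lb _.
  by rewrite ler_pXn2r // nnegrE; move: mu4 lam_gt0; lra.
rewrite -Gn in muE.
have [T form] := extremal_core_triangle kt g0_itv k_gt0 Gb mu_G x_ge0 sub
  mu4 al1 mu_al mu_be muE cL xL xQ.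
by have := core_triangle_giso form; rewrite cL Gn.
Qed.
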